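(* Let $H$ be a complex Hilbert space and let $T\in\mathcal{L}(H)$. Suppose that there exist a complex Hilbert space $K$, a contraction $Q\in\mathcal{L}(K)$ and an isometry $V\in\mathcal{L}(H,K)$ such that the operators $$E_{n}:=2V^{*}Q^{*n}V-T^{*n}\in\mathcal{L}(H),\qquad n\in\mathbb{N},$$ are uniformly bounded, i.e. $\sup_{n\in\mathbb{N}}\|E_n\|<\infty$, and each commutes with $T$, i.e. $E_nT=TE_n$ for all $n\in\mathbb{N}$. Then $\|T\|\leq 2$.
   Context: $\mathcal{L}(H)$ denotes the space of bounded linear operators on $H$ and $\mathcal{L}(H,K)$ the space of bounded linear operators from $H$ to $K$, with the operator norm. $\mathbb{N}=\{1,2,3,\dots\}$. A contraction is an operator with $\|Q\|\leq 1$; an isometry satisfies $V^{*}V=I$. $T^{*n}$ and $Q^{*n}$ denote $(T^{*})^{n}$ and $(Q^{*})^{n}$. *)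

(* Defs.v *)
From HB Require Import structures.
From mathcomp Require Import all_boot all_order all_algebra sesquilinear.
From mathcomp Require Import complex.
From mathcomp Require Import all_classical all_reals all_analysis.

Set Implicit Arguments.
Unset Strict Implicit.
Unset Printing Implicit Defensive.

Import Order.TTheory GRing.Theory Num.Theory.
Import numFieldNormedType.Exports.

Local Open Scope classical_set_scope.
Local Open Scope ring_scope.

(* The elements of [{dot H for Num.conj}] are the positive definite Hermitian
   forms, linear on the left and conjugate-linear on the right.  By [hdotE] the
   norm of [H] is the one induced by the inner product, so that completeness of
   [H] is completeness for the induced norm. *)
HB.mixin Record isHilbert (R : realType) H
    of CompleteNormedModule R[i] H := {
  hdot : {dot H for (@Num.conj R[i])} ;
  hdotE : forall x : H, `|x| ^+ 2 = hdot x x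
}.

#[short(type="hilbertType")]
HB.structure Definition Hilbert (R : realType) :=
  {H of isHilbert R H & CompleteNormedModule R[i] H}.

Section operators.
Context {R : realType}.
Implicit Types H K : hilbertType R.

(* The norm of a normed module over [R[i]] takes its (real) values in [R[i]];
   [complex.Re] brings them back to [R].  The supremum is taken in [\bar R], so
   that it is [+oo] for unbounded linear maps. *)
Definition opnorm H K (f : H -> K) : \bar R :=
  ereal_sup [set (complex.Re `|f x|)%:E | x in [set x : H | `|x| <= 1]].

(* For bounded linear [f], the Riesz representation theorem shows that exactly
   one [x] satisfies the condition below. *)
Definition adj H K (f : H -> K) : K -> H :=
  fun y => get [set x : H | forall z : H, hdot (f z) y = hdot z x].

End operators.

HB.mixin Record isBoundedMap (R : realType) (H K : hilbertType R)
    (f : H -> K) := {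
  opnorm_ltey : (opnorm f < +oo)%E
}.

#[short(type="boundedOp")]
HB.structure Definition BoundedOp (R : realType) (H K : hilbertType R) :=
  {f of isBoundedMap R H K f & @GRing.Linear R[i] H K *:%R f}.

(* Main.v *)
Require Import Defs.
From mathcomp Require Import all_boot all_order all_algebra.
From mathcomp Require Import all_classical all_reals all_analysis.
From mathcomp Require Import sesquilinear complex ring lra.

Import Order.TTheory GRing.Theory Num.Theory.
Import numFieldNormedType.Exports.

Local Open Scope classical_set_scope.
Local Open Scope ring_scope.

(** Write [x, y] for the real part of the inner product and A* for the adjoint
    of A.  Since T*^n = 2 V* Q*^n V - E_n, the powers of T are uniformly bounded,
    so for 0 <= w <= 1/2 the positive operator

      G_w = sum_n w^n T^n T*^n

    ([gram]) exists.  Write G = G_(1/2), G' = G_(1/4), and let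
    L h = sum_n 2^-n Q^n V T*^n h ([lift]) be the analogous series with values
    in K.  Then 2 V* L = G + X, where X = sum_n 2^-n E_n* T*^n commutes with T*
    because every E_n commutes with T ([cross_comm]).

    There are two estimates of |L h|.
    - Since L h - V h = (1/2) Q L (T* h) and Q is a contraction,
      |L h|^2 <= (1/4) |L T* h|^2 + 2 [L h, V h] - |h|^2.  Iterating along
      h, T* h, T*^2 h, and so on, and moving T* through X, sums this up to
      |L h|^2 <= 2 [(G - G') h, h] + [X h, G' h]  ([lift_sqr_le]).
    - Since V* is a contraction, |L h|^2 >= |V* L h|^2 = (1/4) |(G + X) h|^2.
    Completing the square by |V* L h - G' h|^2 >= 0 makes X disappear:

      [(G - G') h, G' h] <= 2 [(G - G') h, h]      ([gram_cross_le]).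

    If G' were a scalar, this would say that G' <= 2.  It does so in general:
    take h nearly maximizing [G' h, h] on the unit ball, so that G' h is nearly
    mu h with mu the norm of G'.  If mu > 2 the inequality forces [(G - G') h, h]
    to be nearly 0; but (1/4) |T* h|^2 <= [(G - G') h, h], so T* h is nearly 0,
    and then [G' h, h] is nearly |h|^2 <= 1, which is absurd ([gram_le2]).
    Finally |h|^2 + (1/4) |T* h|^2 <= [G' h, h] <= 2 |h|^2 gives |T*| <= 2.

    Only real parts of inner products occur, so the argument runs in the
    underlying real Hilbert space.  The definition of the adjoint as a chosen
    representing vector becomes usable through the Riesz theorem, proved here by
    minimizing |z|^2 - 2 phi(z).  All limits converge geometrically, and are
    handled through explicit bounds by multiples of 2^-n. *)

(** * Real sequences controlled by powers of 1/2 *)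

Lemma geometric_lt {R : realType} (C e : R) :
  0 < e -> exists n, C * 2^-1 ^+ n < e.
Proof.
move=> e0; have h1 : `|2^-1 : R| < 1 by rewrite ger0_norm; lra.
have /cvgrPdist_lt/(_ _ e0)[n _ /(_ n (leqnn n))] := cvg_geometric C h1.
by rewrite sub0r normrN => /(le_lt_trans (ler_norm _)); exists n.
Qed.

Lemma geometric_le0 {R : realType} (C a : R) :
  (forall n, a <= C * 2^-1 ^+ n) -> a <= 0.
Proof.
move=> aC; apply/ler_addgt0Pr => e /(geometric_lt C)[n Cn].
by rewrite add0r (le_trans (aC n)) // ltW.
Qed.

(** Iterating [a n <= r * a n.+1] bounds [a 0] by [r ^+ n * C] for every [n]. *)
Lemma geometric_descent {R : realType} (r C : R) (a : nat -> R) :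
  0 <= r <= 2^-1 -> (forall n, a n <= r * a n.+1) -> (forall n, a n <= C) ->
  a 0%N <= 0.
Proof.
move=> /andP[r0 r2] ar aC.
have arn n : a 0%N <= r ^+ n * a n.
  elim: n => [|n IH]; first by rewrite expr0 mul1r.
  by rewrite (le_trans IH) // exprSr -mulrA ler_wpM2l ?exprn_ge0.
apply: (@geometric_le0 _ `|C|) => n; rewrite (le_trans (arn n)) //.
rewrite mulrC (le_trans (ler_wpM2r (exprn_ge0 n r0) (aC n))) //.
rewrite (le_trans (ler_wpM2r (exprn_ge0 n r0) (ler_norm C))) //.
by rewrite ler_wpM2l // lerXn2r ?nnegrE //; lra.
Qed.

(** * The underlying real Hilbert space *)

Section RealInnerProduct.
Context {R : realType} {H : hilbertType R}.
Implicit Types (x y z : H) (a : R).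

Lemma Re_realM a (z : R[i]) : complex.Re (a%:C%C * z) = a * complex.Re z.
Proof. by case: z => b c; rewrite -[LHS]/(a * b - 0 * c) mul0r subr0. Qed.

Definition rdot x y : R := complex.Re (hdot x y).
Definition rnorm x : R := complex.Re `|x|.

Lemma normE x : `|x| = (rnorm x)%:C%C.
Proof. by rewrite /rnorm RRe_real // normr_real. Qed.

Lemma rnorm_ge0 x : 0 <= rnorm x.
Proof. by have := normr_ge0 x; rewrite normE lecE /= => /andP[]. Qed.

Lemma rdotxx x : rdot x x = rnorm x ^+ 2.
Proof. by rewrite /rdot -hdotE normE -rmorphXn. Qed.

Lemma rdotC x y : rdot x y = rdot y x.
Proof. by rewrite /rdot [hdot x y]hermC /= expr0 mul1r; case: (hdot y x). Qed.

Lemma rdotDl x y z : rdot (x + y) z = rdot x z + rdot y z.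
Proof. by rewrite /rdot linearDl raddfD. Qed.

Lemma rdotDr x y z : rdot z (x + y) = rdot z x + rdot z y.
Proof. by rewrite rdotC rdotDl ![rdot _ z]rdotC. Qed.

Lemma rdotZl a x y : rdot (a%:C%C *: x) y = a * rdot x y.
Proof. by rewrite /rdot linearZl_LR /= Re_realM. Qed.

Lemma rdotZr a x y : rdot x (a%:C%C *: y) = a * rdot x y.
Proof. by rewrite rdotC rdotZl rdotC. Qed.

Lemma rdot0l x : rdot 0 x = 0.
Proof. by rewrite -(scale0r (0 : H)) (rdotZl 0) mul0r. Qed.

Lemma rdot0r x : rdot x 0 = 0.
Proof. by rewrite rdotC rdot0l. Qed.

Lemma rdotNl x y : rdot (- x) y = - rdot x y.
Proof. by apply/eqP; rewrite -addr_eq0 -rdotDl addNr rdot0l. Qed.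

Lemma rdotNr x y : rdot x (- y) = - rdot x y.
Proof. by rewrite rdotC rdotNl rdotC. Qed.

Lemma rdotBl x y z : rdot (x - y) z = rdot x z - rdot y z.
Proof. by rewrite rdotDl rdotNl. Qed.

Lemma rdotBr x y z : rdot z (x - y) = rdot z x - rdot z y.
Proof. by rewrite rdotDr rdotNr. Qed.

Lemma rdot_suml n (F : 'I_n -> H) x :
  rdot (\sum_i F i) x = \sum_i rdot (F i) x.
Proof. exact: (big_morph (rdot^~ x) (fun u v => rdotDl u v x) (rdot0l x)). Qed.

Lemma rnorm0 : rnorm (0 : H) = 0.
Proof. by rewrite /rnorm normr0. Qed.

Lemma rnorm_eq0 x : rnorm x = 0 -> x = 0.
Proof. by move=> x0; apply/normr0_eq0; rewrite normE x0. Qed.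

Lemma rnormZ a x : rnorm (a%:C%C *: x) = `|a| * rnorm x.
Proof.
by rewrite /rnorm normrZ normc_def /= expr0n addr0 sqrtr_sqr Re_realM.
Qed.

Lemma ler_rnormD x y : rnorm (x + y) <= rnorm x + rnorm y.
Proof. by have := ler_normD x y; rewrite !normE -rmorphD lecE => /andP[]. Qed.

Lemma rnormN x : rnorm (- x) = rnorm x.
Proof. by rewrite /rnorm normrN. Qed.

(** Cauchy-Schwarz, by expanding the square of [|y| x - |x| y]. *)
Lemma ler_rdot x y : rdot x y <= rnorm x * rnorm y.
Proof.
have := rnorm_ge0 x; rewrite le_eqVlt => /orP[/eqP/esym/rnorm_eq0 ->|x0].
  by rewrite rdot0l rnorm0 mul0r.
have := rnorm_ge0 y; rewrite le_eqVlt => /orP[/eqP/esym/rnorm_eq0 ->|y0].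
  by rewrite rdot0r rnorm0 mulr0.
have : 0 <= rdot ((rnorm y)%:C%C *: x - (rnorm x)%:C%C *: y)
                 ((rnorm y)%:C%C *: x - (rnorm x)%:C%C *: y).
  by rewrite rdotxx sqr_ge0.
rewrite !(rdotBl, rdotBr, rdotZl, rdotZr) [rdot y x]rdotC !rdotxx => h.
have : 0 <= (rnorm x * rnorm y) * (2 * (rnorm x * rnorm y - rdot x y)) by nra.
by rewrite pmulr_rge0 ?mulr_gt0 // pmulr_rge0 // subr_ge0.
Qed.

Lemma ler_norm_rdot x y : `|rdot x y| <= rnorm x * rnorm y.
Proof.
by rewrite ler_norml lerNl -rdotNl -[in leRHS](rnormN x) !ler_rdot.
Qed.

Lemma rdot_inj x y : (forall z, rdot z x = rdot z y) -> x = y.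
Proof.
move=> xy; apply/subr0_eq/rnorm_eq0/eqP.
by rewrite -(sqrf_eq0 (rnorm _)) -rdotxx rdotBr xy subrr.
Qed.

(** Completeness in quantitative form: a geometric Cauchy rate is also the rate
    of convergence to the limit. *)
Lemma hilbert_complete (C : R) (u : nat -> H) :
  (forall n m, (n <= m)%N -> rnorm (u m - u n) <= C * 2^-1 ^+ n) ->
  exists l, forall n, rnorm (u n - l) <= C * 2^-1 ^+ n.
Proof.
move=> uC.
have /cauchy_cvgP : cauchy (u @ \oo).
  apply: cauchy_exP => e e0.
  have [e1 eE] : exists e1 : R, e = e1%:C%C.
    by exists (complex.Re e); rewrite RRe_real // gtr0_real.
  have e10 : 0 < e1 by move: e0; rewrite eE ltcE => /andP[].
  have [n nC] := geometric_lt C e1 e10.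
  exists (u n); exists n => // m /= nm.
  rewrite -ball_normE /= distrC normE eE ltcE eqxx /=.
  exact: le_lt_trans (uC _ _ nm) nC.
move=> /cvg_ex[l /= ul]; exists l => n; apply/ler_addgt0Pr => e e0.
have e0' : 0 < e%:C%C :> R[i] by rewrite ltcE eqxx.
have /cvgrPdist_lt/(_ _ e0')[m _ mu] := ul.
have := mu (maxn m n) (leq_maxl m n).
rewrite distrC normE ltcE eqxx /= => h1.
have := uC n _ (leq_maxr m n); rewrite -rnormN opprB => h2.
have := ler_rnormD (u n - u (maxn m n)) (u (maxn m n) - l).
by rewrite subrKA => h3; lra.
Qed.

End RealInnerProduct.

(** * Bounded operators and their adjoints *)

Section OperatorNorm.
Context {R : realType}.
Implicit Types H K : hilbertType R.

Lemma opnorm_le_rnorm {H K} (f : H -> K) (B : R) :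
  (forall a x, f (a%:C%C *: x) = a%:C%C *: f x) -> (opnorm f <= B%:E)%E ->
  forall x, rnorm (f x) <= B * rnorm x.
Proof.
move=> fZ fB x.
have := rnorm_ge0 x; rewrite le_eqVlt => /orP[/eqP/esym/rnorm_eq0 ->|x0].
  by have := fZ 0 0; rewrite rmorph0 !scale0r => ->; rewrite !rnorm0 mulr0.
have : ((rnorm (f (((rnorm x)^-1)%:C%C *: x)))%:E <= B%:E)%E.
  apply: le_trans fB; apply: ereal_sup_ubound.
  exists (((rnorm x)^-1)%:C%C *: x) => //=.
  by rewrite normE rnormZ ger0_norm ?invr_ge0 ?(ltW x0) // mulVf ?gt_eqF.
rewrite lee_fin fZ rnormZ ger0_norm ?invr_ge0 ?(ltW x0) //.
by rewrite mulrC ler_pdivrMr.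
Qed.

Lemma rnorm_le_opnorm {H K} (f : H -> K) (B : R) : 0 <= B ->
  (forall x, rnorm (f x) <= B * rnorm x) -> (opnorm f <= B%:E)%E.
Proof.
move=> B0 fB; apply: ub_ereal_sup => _ [x /= x1 <-].
rewrite lee_fin (le_trans (fB x)) // ler_piMr //.
by move: x1; rewrite normE lecE => /andP[].
Qed.

Lemma linear_realZ {H K} (f : {linear H -> K}) a x :
  f (a%:C%C *: x) = a%:C%C *: f x.
Proof. exact: linearZ. Qed.

Lemma opnorm_ge0 {H K} (f : H -> K) : f 0 = 0 -> (0 <= opnorm f)%E.
Proof.
move=> f0; apply: ereal_sup_ubound; exists 0 => /=; first by rewrite normr0.
by rewrite f0 normr0.
Qed.

Lemma boundedOp_le {H K} (f : boundedOp H K) :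
  exists B : R, forall x, rnorm (f x) <= B * rnorm x.
Proof.
have := opnorm_ltey (s := f); have := opnorm_ge0 f (linear0 f).
case fB : (opnorm f) => [B| |] // _ _; exists B.
by apply: opnorm_le_rnorm; [exact: linear_realZ | rewrite fB].
Qed.

(** The Riesz representation theorem for real functionals.  The representing
    vector minimizes [F z = |z|^2 - 2 phi z]: by the parallelogram identity a
    minimizing sequence is Cauchy, and the first variation of [F] vanishes at its
    limit. *)
Lemma riesz (H : hilbertType R) (phi : H -> R) (C : R) :
  (forall x y, phi (x + y) = phi x + phi y) ->
  (forall a x, phi (a%:C%C *: x) = a * phi x) ->
  (forall x, phi x <= C * rnorm x) ->
  exists x, forall z, phi z = rdot z x.
Proof.
move=> phiD phiZ phiC.
pose F z := rdot z z - 2 * phi z.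
pose m := inf (range F).
have mF z : m <= F z.
  suff Flb : has_lbound (range F) by apply: (ge_inf Flb); exists z.
  exists (- C ^+ 2) => _ [w _ <-]; rewrite /F rdotxx.
  have := phiC w; have := sqr_ge0 (rnorm w - C); nra.
have /choice[u uF] : forall n, exists z, F z < m + (2^-1 ^+ n) ^+ 2.
  move=> n; have : m < m + (2^-1 ^+ n) ^+ 2.
    by rewrite ltrDl exprn_gt0 // exprn_gt0 // invr_gt0.
  by move=> /inf_lt[|_ [z _ <-] ?]; [exists (F 0), 0 | exists z].
have half_gt0 n : 0 < 2^-1 ^+ n :> R by rewrite exprn_gt0 // invr_gt0.
have [x ux] : exists x, forall n, rnorm (u n - x) <= 2 * 2^-1 ^+ n.
  apply: hilbert_complete => n k nk.
  have kn : (2^-1 ^+ k) <= 2^-1 ^+ n :> R by rewrite ler_wiXn2l //; lra.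
  have h0 : 0 <= 2 * 2^-1 ^+ n :> R by rewrite mulr_ge0 // ltW.
  rewrite -(ler_sqr (rnorm_ge0 _) h0) -rdotxx.
  have := mF (2^-1%:C%C *: (u k + u n)).
  have := uF n; have := uF k; rewrite /F phiZ phiD.
  rewrite !(rdotZl, rdotZr, rdotDl, rdotDr, rdotNl, rdotNr).
  rewrite [rdot (u n) (u k)]rdotC.
  have := half_gt0 n; have := half_gt0 k; nra.
exists x => z.
(* Compare [F (u n)] with [F (u n + a z)] for [a] equal to [2^-n] and to
   [- 2^-n]: since [u n] is minimal up to [4^-n], this steps down by a first
   order term, which is therefore of size [2^-n]. *)
have var n : `|rdot z (u n) - phi z| <= (rnorm z ^+ 2 + 1) * 2^-1 ^+ n.
  have h0 := half_gt0 n.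
  have key a : a ^+ 2 = (2^-1 ^+ n) ^+ 2 ->
      0 <= 2 * (a * (rdot z (u n) - phi z)) +
        (rnorm z ^+ 2 + 1) * (2^-1 ^+ n) ^+ 2.
    move=> aE; have := mF (u n + a%:C%C *: z); have := uF n.
    rewrite /F phiD phiZ !(rdotDl, rdotDr, rdotZl, rdotZr).
    by rewrite [rdot (u n) z]rdotC (rdotxx z); nra.
  have := key _ (erefl _); have := key (- 2^-1 ^+ n) (sqrrN _).
  set d := rdot z (u n) - phi z; set N := _ + 1; set h := _ ^+ n in h0 *.
  move=> k1 k2.
  have : 0 <= h * (2 * d + N * h) by nra.
  have : 0 <= h * (- 2 * d + N * h) by nra.
  rewrite !(pmulr_rge0 _ h0) ler_norml.
  have : 0 <= N * h by rewrite mulr_ge0 ?addr_ge0 ?sqr_ge0 ?ltW.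
  by move=> ? ? ?; apply/andP; split; lra.
apply/eqP; rewrite -subr_eq0 -normr_le0.
apply: (@geometric_le0 _ (rnorm z ^+ 2 + 1 + rnorm z * 2)) => n.
have := var n; rewrite !ler_norml mulrDl => /andP[d1 d2].
have h1 : rnorm z * rnorm (u n - x) <= rnorm z * 2 * 2^-1 ^+ n.
  by rewrite -mulrA ler_wpM2l ?rnorm_ge0.
have := ler_norm_rdot z (u n - x); rewrite rdotBr ler_norml => /andP[e1 e2].
by apply/andP; split; lra.
Qed.

(** A real functional determines the complex functional of which it is the real
    part, because [Re ('i * w) = - Im w]; hence a vector that represents
    [z |-> rdot (f z) y] satisfies the complex condition that defines [adj]. *)
Lemma adjP {H K : hilbertType R} (f : boundedOp H K) (z : H) (y : K) :
  rdot (f z) y = rdot z (adj f y).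
Proof.
have [B fB] := boundedOp_le f.
have [|||x fx] := @riesz H (fun z => rdot (f z) y) (B * rnorm y).
- by move=> u v; rewrite linearD rdotDl.
- by move=> a u; rewrite linear_realZ rdotZl.
- move=> u; rewrite (le_trans (ler_rdot _ _)) // mulrAC.
  by rewrite ler_wpM2r ?rnorm_ge0.
have fxh u : hdot (f u) y = hdot u x.
  have := fx ('i%C *: u); have := fx u.
  rewrite /rdot linearZ !linearZl_LR /=.
  rewrite ![_ * hdot _ _]mulrC !ReiNIm.
  case: (hdot (f u) y) => a b; case: (hdot u x) => c d /= -> /oppr_inj -> //.
have /= := @getPex _ [set x : H | forall z : H, hdot (f z) y = hdot z x].
by rewrite /rdot => ->; last by exists x.
Qed.

Lemma adjoint_le {H K} (f : H -> K) (fs : K -> H) (B : R) :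
  0 <= B -> (forall x y, rdot (f x) y = rdot x (fs y)) ->
  (forall x, rnorm (f x) <= B * rnorm x) ->
  forall y, rnorm (fs y) <= B * rnorm y.
Proof.
move=> B0 f_adj fB y.
have fy : rnorm (fs y) * rnorm (fs y) <= (B * rnorm y) * rnorm (fs y).
  rewrite -expr2 -rdotxx -f_adj (le_trans (ler_rdot _ _)) // mulrAC.
  by rewrite ler_wpM2r ?rnorm_ge0.
have := rnorm_ge0 (fs y); rewrite le_eqVlt => /orP[/eqP fs0|fs0].
  by rewrite -fs0 mulr_ge0 ?rnorm_ge0.
by rewrite -(ler_pM2r fs0).
Qed.

Lemma adjoint_realZ {H K} (f : H -> K) (fs : K -> H) a y :
  (forall x y, rdot (f x) y = rdot x (fs y)) ->
  fs (a%:C%C *: y) = a%:C%C *: fs y.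
Proof. by move=> f_adj; apply: rdot_inj => z; rewrite -f_adj !rdotZr f_adj. Qed.

Lemma iter_adjoint {H} (f fs : H -> H) n x y :
  (forall x y, rdot (f x) y = rdot x (fs y)) ->
  rdot (iter n f x) y = rdot x (iter n fs y).
Proof. by move=> f_adj; elim: n y => //= n IH y; rewrite f_adj IH -iterSr. Qed.

Lemma iter_le {H} (f : H -> H) n x :
  (forall x, rnorm (f x) <= rnorm x) -> rnorm (iter n f x) <= rnorm x.
Proof. by move=> f1; elim: n => //= n IH; rewrite (le_trans (f1 _)). Qed.

End OperatorNorm.

(** * Geometrically weighted operator series *)

Section OperatorSeries.
Context {R : realType} {H K : hilbertType R}.
Variables (r : R) (A : H -> K) (B : boundedOp K K) (D : H -> H).

Definition op_partial n (h : H) : K :=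
  \sum_(i < n) (r ^+ i)%:C%C *: iter i B (A (iter i D h)).

Lemma op_partialS n h :
  op_partial n.+1 h = A h + r%:C%C *: B (op_partial n (D h)).
Proof.
rewrite /op_partial big_ord_recl /= expr0 scale1r; congr (_ + _).
rewrite linear_sum scaler_sumr; apply: eq_bigr => i _.
by rewrite linear_realZ scalerA -rmorphM exprS -iterSr.
Qed.

Definition geometric_limit h l :=
  exists M, forall n, rnorm (op_partial n h - l) <= M * 2^-1 ^+ n.

(** The sum over all [n] of [r ^ n B ^ n A D ^ n h]. *)
Definition op_series h : K := get [set l | geometric_limit h l].

Variable C : R.
Hypothesis r_half : 0 <= r <= 2^-1.
Hypothesis C_ge0 : 0 <= C.
Hypothesis termC : forall i h, rnorm (iter i B (A (iter i D h))) <= C * rnorm h.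

(** The tail is dominated by the geometric series of ratio 1/2, whatever the
    weight [r] below 1/2. *)
Lemma op_partial_tail h n k : rnorm (op_partial (n + k) h - op_partial n h) <=
  2 * C * rnorm h * (2^-1 ^+ n - 2^-1 ^+ (n + k)).
Proof.
elim: k => [|k IH]; first by rewrite addn0 !subrr rnorm0 mulr0.
rewrite addnS {1}/op_partial big_ord_recr -/(op_partial _ h) /= addrAC.
rewrite (le_trans (ler_rnormD _ _)) // rnormZ ger0_norm; last first.
  by rewrite exprn_ge0 //; case/andP: r_half.
have Ch : 0 <= C * rnorm h by rewrite mulr_ge0 ?rnorm_ge0.
have h1 := ler_wpM2r Ch (_ : r ^+ (n + k) <= 2^-1 ^+ (n + k)).
have h2 : r ^+ (n + k) <= 2^-1 ^+ (n + k).
  by case/andP: r_half => ? ?; rewrite lerXn2r ?nnegrE //; lra.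
have h3 : 0 <= r ^+ (n + k) by rewrite exprn_ge0 //; case/andP: r_half.
have := ler_wpM2l h3 (termC (n + k) h); have := h1 h2.
rewrite exprS; lra.
Qed.

Lemma op_series_lim n h :
  rnorm (op_partial n h - op_series h) <= 2 * C * rnorm h * 2^-1 ^+ n.
Proof.
have [l hl] : exists l, forall n,
    rnorm (op_partial n h - l) <= 2 * C * rnorm h * 2^-1 ^+ n.
  apply: hilbert_complete => p m pm.
  rewrite -(subnKC pm) (le_trans (op_partial_tail _ _ _)) // ler_wpM2l //.
    by rewrite !mulr_ge0 ?rnorm_ge0.
  by rewrite gerBl exprn_ge0.
have /getPex[M hM] : exists l, geometric_limit h l.
  by exists l; eexists; exact: hl.
suff -> : op_series h = l by [].
apply/subr0_eq/rnorm_eq0/le_anti; rewrite rnorm_ge0 andbT.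
apply: (@geometric_le0 _ (2 * C * rnorm h + M)) => p.
have := ler_rnormD (op_partial p h - l) (- (op_partial p h - op_series h)).
rewrite rnormN opprB addrC subrKA => /le_trans; apply.
by rewrite mulrDl lerD.
Qed.

Lemma op_series_le h : rnorm (op_series h) <= 2 * C * rnorm h.
Proof.
have := op_series_lim 0%N h.
by rewrite /op_partial big_ord0 sub0r rnormN expr0 mulr1.
Qed.

Lemma op_series_rec h : op_series h = A h + r%:C%C *: B (op_series (D h)).
Proof.
have [b bB] := boundedOp_le B.
apply/subr0_eq/rnorm_eq0/le_anti; rewrite rnorm_ge0 andbT.
have r0 : 0 <= r by case/andP: r_half.
pose M := C * rnorm h + r * (`|b| * (2 * C * rnorm (D h))).
apply: (@geometric_le0 _ M) => n.
have -> : op_series h - (A h + r%:C%C *: B (op_series (D h))) =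
    (op_series h - op_partial n.+1 h) +
    r%:C%C *: B (op_partial n (D h) - op_series (D h)).
  by rewrite op_partialS linearB scalerBr !opprD !addrA subrK.
rewrite (le_trans (ler_rnormD _ _)) // rnormZ ger0_norm // -rnormN opprB.
rewrite mulrDl lerD //.
  by rewrite (le_trans (op_series_lim _ _)) // exprS; lra.
rewrite -!mulrA ler_wpM2l // (le_trans (bB _)) //.
rewrite (le_trans (ler_wpM2r (rnorm_ge0 _) (ler_norm b))) // ler_wpM2l //.
by rewrite (le_trans (op_series_lim _ _)) // !mulrA.
Qed.

End OperatorSeries.

(** * Weighted Gramians of a power bounded operator *)

Section Gramians.
Context {R : realType} {H : hilbertType R}.
Variables (T : boundedOp H H) (Ts : H -> H) (c : R).
Hypothesis T_adj : forall x y, rdot (T x) y = rdot x (Ts y).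
Hypothesis c_ge0 : 0 <= c.
Hypothesis Ts_bound : forall n x, rnorm (iter n Ts x) <= c * rnorm x.

Lemma power_le n x : rnorm (iter n T x) <= c * rnorm x.
Proof.
apply: (@adjoint_le _ _ _ (iter n Ts)) => // u v.
by rewrite rdotC -(iter_adjoint _ _ _ _ _ T_adj) rdotC.
Qed.

(** The orbits of [Ts] are bounded, so [q] may be iterated along them.  This lets
    one step of the recursion of each series stand for the whole series. *)
Lemma quadratic_descent (r M : R) (q : H -> R) :
  0 <= r <= 2^-1 -> 0 <= M ->
  (forall h, q h <= r * q (Ts h)) -> (forall h, q h <= M * rnorm h ^+ 2) ->
  forall h, q h <= 0.
Proof.
move=> r2 M0 qr qM h.
apply: (@geometric_descent _ r (M * (c * rnorm h) ^+ 2)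
  (fun n => q (iter n Ts h))) => // n.
rewrite (le_trans (qM _)) // ler_wpM2l // ler_sqr ?nnegrE ?rnorm_ge0 //.
by rewrite mulr_ge0 ?rnorm_ge0.
Qed.

Definition gram (w : R) : H -> H := op_series w id T Ts.
Definition gram_form (w : R) h := rdot (gram w h) h.

Let C := 2 * (c * c).

Let C_ge0 : 0 <= C. Proof. by rewrite !mulr_ge0. Qed.

Lemma gram_term_le i h : rnorm (iter i T (iter i Ts h)) <= c * c * rnorm h.
Proof. by rewrite (le_trans (power_le _ _)) // -mulrA ler_wpM2l. Qed.

Section Weight.
Variable w : R.
Hypothesis w_half : 0 <= w <= 2^-1.

Lemma gram_lim n h :
  rnorm (op_partial w id T Ts n h - gram w h) <= C * rnorm h * 2^-1 ^+ n.
Proof. by apply: op_series_lim gram_term_le n h => //; rewrite mulr_ge0. Qed.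

Lemma gram_rec h : gram w h = h + w%:C%C *: T (gram w (Ts h)).
Proof.
by apply: (op_series_rec w id T Ts (c * c)) gram_term_le h => //; rewrite mulr_ge0.
Qed.

Lemma gram_le h : rnorm (gram w h) <= C * rnorm h.
Proof. by apply: op_series_le gram_term_le h => //; rewrite mulr_ge0. Qed.

Lemma gram_form_rec h : gram_form w h = rnorm h ^+ 2 + w * gram_form w (Ts h).
Proof. by rewrite {1}/gram_form gram_rec rdotDl rdotZl T_adj rdotxx. Qed.

Lemma gram_form_le h : `|gram_form w h| <= C * rnorm h ^+ 2.
Proof.
rewrite (le_trans (ler_norm_rdot _ _)) // expr2 mulrA.
by rewrite ler_wpM2r ?rnorm_ge0 ?gram_le.
Qed.

Lemma gram_form_ge0 h : 0 <= gram_form w h.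
Proof.
rewrite -oppr_le0.
apply: (@quadratic_descent w C (fun h => - gram_form w h)) => // x.
  by rewrite gram_form_rec; have := sqr_ge0 (rnorm x); lra.
by have := gram_form_le x; rewrite ler_norml => /andP[]; lra.
Qed.

Lemma gram_sym h k : rdot (gram w h) k = rdot h (gram w k).
Proof.
have le u v : rdot (gram w u) v - rdot u (gram w v) <= 0.
  pose q u v := rdot (gram w u) v - rdot u (gram w v).
  apply: (@geometric_descent _ w (2 * C * (c * rnorm u) * (c * rnorm v))
    (fun n => q (iter n Ts u) (iter n Ts v))) => // n; rewrite /q.
    rewrite gram_rec [gram w (iter n Ts v)]gram_rec.
    rewrite rdotDl rdotDr rdotZl rdotZr T_adj [rdot _ (T _)]rdotC T_adj.
    by rewrite [rdot _ (iter n.+1 Ts u)]rdotC /=; lra.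
  set x := iter n Ts u; set y := iter n Ts v.
  have xy : C * (rnorm x * rnorm y) <= C * ((c * rnorm u) * (c * rnorm v)).
    by rewrite ler_wpM2l // ler_pM ?rnorm_ge0 ?Ts_bound.
  have := ler_norm_rdot (gram w x) y; have := ler_norm_rdot x (gram w y).
  have := ler_wpM2r (rnorm_ge0 y) (gram_le x).
  have := ler_wpM2l (rnorm_ge0 x) (gram_le y).
  by rewrite !ler_norml => ? ? /andP[? ?] /andP[? ?]; lra.
apply/le_anti; rewrite -subr_le0 le /= -subr_le0.
by have := le k h; rewrite rdotC [rdot k _]rdotC.
Qed.

End Weight.

Lemma half_weight : 0 <= (2^-1 : R) <= 2^-1. Proof. by lra. Qed.
Lemma quarter_weight : 0 <= (4^-1 : R) <= 2^-1. Proof. by lra. Qed.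

Local Notation G := (gram 2^-1).
Local Notation G' := (gram 4^-1).
Local Notation g := (gram_form 2^-1).
Local Notation g' := (gram_form 4^-1).

Let gE := gram_form_rec _ half_weight.
Let g'E := gram_form_rec _ quarter_weight.
Let g_ge0 := gram_form_ge0 _ half_weight.
Let g'_ge0 := gram_form_ge0 _ quarter_weight.
Let G'_sym := gram_sym _ quarter_weight.

Lemma gram_diff_ge0 h : g' h <= g h.
Proof.
rewrite -subr_le0.
apply: (@quadratic_descent 2^-1 C (fun h => g' h - g h)) => // [|x|x].
- exact: half_weight.
- by rewrite gE g'E; have := g'_ge0 (Ts x); lra.
- have := gram_form_le _ quarter_weight x; rewrite ler_norml => /andP[].
  by have := g_ge0 x; lra.
Qed.

Lemma gram_diff_ge h : 4^-1 * rnorm (Ts h) ^+ 2 <= g h - g' h.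
Proof.
have := gram_diff_ge0 (Ts h); have := g_ge0 (Ts (Ts h)).
by rewrite [g h]gE [g' h]g'E; have := gE (Ts h); lra.
Qed.

Hypothesis cross_le : forall h,
  rdot (G h) (G' h) - rdot (G' h) (G' h) <= 2 * (g h - g' h).

(** The hypothesis reads [2 D - Re (D G') >= 0] with [D = G - G' >= 0].  At a
    vector of the unit ball where [g'] is nearly maximal, [G'] acts nearly as the
    scalar [mu], so that the form of [(2 - mu) D] is nearly nonnegative there. *)
Lemma gram_le2 h : g' h <= 2 * rnorm h ^+ 2.
Proof.
pose S := [set g' x | x in [set x | rnorm x <= 1]].
have S_ub : has_ubound S.
  exists C => _ [x /= x1 <-]; have := gram_form_le _ quarter_weight x.
  rewrite ler_norml => /andP[_ /le_trans]; apply.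
  by rewrite ler_piMr // expr_le1 ?rnorm_ge0.
have S0 : S !=set0 by exists (g' 0), 0 => //=; rewrite rnorm0.
pose mu := sup S.
have g'mu x : g' x <= mu * rnorm x ^+ 2.
  have := rnorm_ge0 x; rewrite le_eqVlt => /orP[/eqP/esym/rnorm_eq0 ->|x0].
    by rewrite /gram_form rdot0r rnorm0 expr0n mulr0.
  have : g' ((rnorm x)^-1%:C%C *: x) <= mu.
    apply: (ub_le_sup S_ub); exists ((rnorm x)^-1%:C%C *: x) => //=.
    by rewrite rnormZ ger0_norm ?invr_ge0 ?(ltW x0) // mulVf ?gt_eqF.
  rewrite /gram_form rdotZr G'_sym rdotZl -G'_sym mulrA -invfM.
  by rewrite mulrC ler_pdivrMr ?mulr_gt0.
rewrite (le_trans (g'mu h)) // ler_wpM2r ?sqr_ge0 // leNgt; apply/negP => mu2.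
have mu0 : 0 < mu by lra.
have gap x : rnorm x <= 1 -> g' x <= 1 + mu * (g x - g' x).
  move=> x1; rewrite {1}[g' x]g'E.
  have : rnorm x ^+ 2 <= 1 by rewrite expr_le1 ?rnorm_ge0.
  have := g'mu (Ts x); have := ler_wpM2l (ltW mu0) (gram_diff_ge x).
  lra.
(* [k] is the defect of [x] as an eigenvector of [G'] for [mu].  The form
   [mu |z|^2 - g' z] is nonnegative, and its value at [x - k / mu] is at most
   [mu |x|^2 - g' x - |k|^2 / mu], whence [|k|^2 <= mu e^2]. *)
have slack x : rnorm x <= 1 -> forall e : R, 0 < e -> mu - e ^+ 2 < g' x ->
  (mu - 2) * (g x - g' x) <= 2 * C * (mu * e).
  move=> x1 e e0 xe.
  (* Opaque, so that linearity is not applied inside [k]. *)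
  have [k kE] : exists k, k = mu%:C%C *: x - G' x by eexists.
  have k_small : rnorm k <= mu * e.
    have G'xE z : rdot z (G' x) = mu * rdot z x - rdot z k.
      by rewrite kE rdotBr rdotZr; ring.
    have := g'mu (x - mu^-1%:C%C *: k).
    rewrite -rdotxx /gram_form rdotBr rdotZr !G'_sym.
    rewrite !(rdotBl, rdotZl) !(rdotBr, rdotZr).
    rewrite -[rdot x (G' k)]G'_sym [rdot (G' x) k]rdotC.
    rewrite [rdot x k]rdotC -[rdot x (G' x)]G'_sym -/(gram_form _ x).
    rewrite -[rdot k (G' k)]G'_sym -/(gram_form _ k) G'xE !rdotxx => gk.
    have x2 : rnorm x ^+ 2 <= 1 by rewrite expr_le1 ?rnorm_ge0.
    have : mu * rnorm x ^+ 2 - g' x - mu^-1 * rnorm k ^+ 2 >= 0.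
      have := mulr_ge0 (sqr_ge0 mu^-1) (g'_ge0 k).
      have E1 : mu * (mu^-1 * (mu^-1 * rnorm k ^+ 2)) = mu^-1 * rnorm k ^+ 2.
        by rewrite mulVKf ?gt_eqF.
      by nra.
    move=> h2; have : mu^-1 * rnorm k ^+ 2 <= e ^+ 2 by nra.
    rewrite mulrC ler_pdivrMr // => h3.
    rewrite -ler_sqr ?nnegrE ?rnorm_ge0 ?mulr_ge0 ?(ltW mu0) ?(ltW e0) //.
    by rewrite (le_trans h3) // exprMn mulrC ler_wpM2r ?sqr_ge0 //; nra.
  have := cross_le x.
  have -> : rdot (G x) (G' x) - rdot (G' x) (G' x) =
      mu * (g x - g' x) - rdot (G x - G' x) k.
    by rewrite kE rdotBr rdotZr !rdotBl /gram_form; ring.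
  have h1 := ler_rdot (G x - G' x) k.
  have h2 : rnorm (G x - G' x) <= 2 * C.
    have := ler_rnormD (G x) (- G' x); rewrite rnormN.
    have := ler_wpM2l C_ge0 x1.
    by have := gram_le _ half_weight x; have := gram_le _ quarter_weight x; lra.
  have := ler_pM (rnorm_ge0 _) (rnorm_ge0 _) h2 k_small.
  lra.
(* As [C < C + 1], this makes the bound in [slack], multiplied by [mu], less
   than [(mu - 2) / 2]. *)
pose Z := 4 * (C + 1) * mu ^+ 2.
have Z0 : 0 < Z by rewrite /Z mulr_gt0 ?exprn_gt0 // mulr_gt0 // ltr_wpDl.
have [e eZ] : exists e : R, e * Z = mu - 2.
  by exists ((mu - 2) / Z); rewrite divfK ?gt_eqF.
have e0 : 0 < e by rewrite -(pmulr_lgt0 _ Z0) eZ; lra.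
have [_ [x x1 <-] xe] := sup_adherent (exprn_gt0 2 e0) (conj S0 S_ub).
have e2 : e <= 2^-1.
  rewrite -(ler_pM2r Z0) eZ /Z.
  by have := mulr_ge0 C_ge0 (sqr_ge0 mu); nra.
have := slack x x1 e e0 xe; have := gap x x1.
move: xe; rewrite -/mu => xe h1 h2.
have h3 : mu - 1 - e ^+ 2 <= mu * (g x - g' x) by lra.
have h4 : (mu - 2) * (mu - 1 - e ^+ 2) <= mu * (2 * C * (mu * e)).
  have := ler_wpM2l (ltW mu0) h2.
  have := ler_wpM2l (_ : 0 <= mu - 2) h3; lra.
have h5 : mu * (2 * C * (mu * e)) < (mu - 2) / 2.
  have -> : mu * (2 * C * (mu * e)) = (mu - 2) / 2 - 2 * e * mu ^+ 2.
    by rewrite -eZ /Z; field.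
  by rewrite ltrBlDr ltrDl mulr_gt0 ?exprn_gt0 // mulr_gt0.
have h6 : (mu - 2) * 2^-1 <= (mu - 2) * (mu - 1 - e ^+ 2).
  have ee : e ^+ 2 <= 2^-1 by nra.
  by rewrite ler_wpM2l //; lra.
lra.
Qed.

Lemma adjoint_le2 h : rnorm (Ts h) <= 2 * rnorm h.
Proof.
have TsF : rnorm (Ts h) ^+ 2 <= g' (Ts h).
  by rewrite [g' _]g'E; have := g'_ge0 (Ts (Ts h)); lra.
rewrite -ler_sqr ?nnegrE ?rnorm_ge0 ?mulr_ge0 ?rnorm_ge0 //.
by have := gram_le2 h; rewrite [g' h]g'E exprMn; lra.
Qed.

End Gramians.

(** * The lift to the dilation space *)

Section Dilation.
Context {R : realType} {H K : hilbertType R}.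
Variables (T : boundedOp H H) (Ts : H -> H) (c : R).
Hypothesis T_adj : forall x y, rdot (T x) y = rdot x (Ts y).
Hypothesis c_ge0 : 0 <= c.
Hypothesis Ts_bound : forall n x, rnorm (iter n Ts x) <= c * rnorm x.
Variables (Q : boundedOp K K) (Qs : K -> K) (V : boundedOp H K) (Vs : K -> H).
Hypothesis Q_adj : forall x y, rdot (Q x) y = rdot x (Qs y).
Hypothesis V_adj : forall x y, rdot (V x) y = rdot x (Vs y).
Hypothesis Q_contr : forall x, rnorm (Q x) <= rnorm x.
Hypothesis VsV : forall x, Vs (V x) = x.

Definition defect n x := 2 *: Vs (iter n Qs (V x)) - iter n Ts x.
Hypothesis defect_comm : forall n x, defect n (T x) = T (defect n x).

Lemma isometry_norm x : rnorm (V x) = rnorm x.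
Proof.
apply/eqP; rewrite -(@eqrXn2 _ 2 _ _ isT (rnorm_ge0 _) (rnorm_ge0 _)).
by rewrite -!rdotxx V_adj VsV.
Qed.

Lemma coisometry_le k : rnorm (Vs k) <= rnorm k.
Proof.
rewrite -[leRHS]mul1r; apply: (adjoint_le V) => // u.
by rewrite mul1r isometry_norm.
Qed.

Definition lift : H -> K := op_series 2^-1 V Q Ts.

Local Notation G := (gram T Ts 2^-1).
Local Notation G' := (gram T Ts 4^-1).

Let lift_term_le i h : rnorm (iter i Q (V (iter i Ts h))) <= c * rnorm h.
Proof. by rewrite (le_trans (iter_le _ _ _ Q_contr)) ?isometry_norm. Qed.

Lemma lift_lim n h :
  rnorm (op_partial 2^-1 V Q Ts n h - lift h) <= 2 * c * rnorm h * 2^-1 ^+ n.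
Proof. by apply: op_series_lim lift_term_le n h => //; exact: half_weight. Qed.

Lemma lift_rec h : lift h = V h + 2^-1%:C%C *: Q (lift (Ts h)).
Proof.
by apply: (op_series_rec 2^-1 V Q Ts c) lift_term_le h => //; exact: half_weight.
Qed.

Lemma lift_le h : rnorm (lift h) <= 2 * c * rnorm h.
Proof. by apply: op_series_le lift_term_le h => //; exact: half_weight. Qed.

(** The form [X h, w] of the operator X = 2 V* L - G. *)
Definition cross h w := 2 * rdot (lift h) (V w) - rdot (G h) w.

(** The terms of index [i] of [2 V* L h] and [G h] combine into the adjoint of
    [defect i], which is E_i. *)
Lemma cross_lim n h w :
  `|cross h w - \sum_(i < n) 2^-1 ^+ i * rdot (iter i Ts h) (defect i w)| <=
  (4 * c + 2 * (c * c)) * (rnorm h * rnorm w) * 2^-1 ^+ n.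
Proof.
have -> : \sum_(i < n) 2^-1 ^+ i * rdot (iter i Ts h) (defect i w) =
    2 * rdot (op_partial 2^-1 V Q Ts n h) (V w) -
    rdot (op_partial 2^-1 id T Ts n h) w.
  rewrite /op_partial !rdot_suml mulr_sumr -sumrB; apply: eq_bigr => i _.
  rewrite !rdotZl (iter_adjoint _ _ _ _ _ Q_adj) (iter_adjoint _ _ _ _ _ T_adj).
  rewrite V_adj /defect rdotBr.
  have -> : 2 = (2 : R)%:C%C :> R[i] by rewrite rmorph_nat.
  by rewrite rdotZr; ring.
set Ln := op_partial _ V _ _ _ _; set Gn := op_partial _ id _ _ _ _.
have -> : cross h w - (2 * rdot Ln (V w) - rdot Gn w) =
   rdot (Gn - G h) w - 2 * rdot (Ln - lift h) (V w).
  by rewrite /cross !rdotBl; ring.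
have L1 := lift_lim n h.
have G1 := gram_lim _ _ _ T_adj c_ge0 Ts_bound _ half_weight n h.
have w0 := rnorm_ge0 w.
rewrite (le_trans (ler_normB _ _)) // normrM ger0_norm //.
have := ler_norm_rdot (Gn - G h) w.
have := ler_norm_rdot (Ln - lift h) (V w); rewrite isometry_norm => h1 h2.
have := ler_wpM2r w0 L1; have := ler_wpM2r w0 G1.
by lra.
Qed.

(** The commutation of the defect operators with [T] passes to the sum: [X]
    commutes with [T*]. *)
Lemma cross_comm h w : cross h (T w) = cross (Ts h) w.
Proof.
apply/eqP; rewrite -subr_eq0 -normr_le0.
apply: (@geometric_le0 _ ((4 * c + 2 * (c * c)) * (rnorm h * rnorm (T w)) +
  (4 * c + 2 * (c * c)) * (rnorm (Ts h) * rnorm w))) => n.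
have := cross_lim n h (T w); have := cross_lim n (Ts h) w.
rewrite [X in `|cross h _ - X|](_ : _ =
  \sum_(i < n) 2^-1 ^+ i * rdot (iter i Ts (Ts h)) (defect i w)); last first.
  apply: eq_bigr => i _; rewrite defect_comm -iterSr /= rdotC T_adj.
  by rewrite [rdot (defect i w) _]rdotC.
rewrite !ler_norml mulrDl => /andP[? ?] /andP[? ?].
by apply/andP; split; lra.
Qed.

Let gE := gram_form_rec _ _ _ T_adj c_ge0 Ts_bound _ half_weight.
Let g'E := gram_form_rec _ _ _ T_adj c_ge0 Ts_bound _ quarter_weight.
Let G_le := gram_le _ _ _ T_adj c_ge0 Ts_bound _ half_weight.
Let G'_le := gram_le _ _ _ T_adj c_ge0 Ts_bound _ quarter_weight.

(** The difference [q] of the two sides satisfies [q h <= q (Ts h) / 4].  On the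
    left this is the contractivity of [Q] in [lift_rec].  On the right, the
    recursions of the two Gramian forms leave [g h - |h|^2] and the one of [G']
    leaves [cross h h], once [T*] has been moved through [X]. *)
Lemma lift_sqr_le h :
  rnorm (lift h) ^+ 2 <=
  2 * (gram_form T Ts 2^-1 h - gram_form T Ts 4^-1 h) + cross h (G' h).
Proof.
rewrite -subr_le0.
pose q h := rnorm (lift h) ^+ 2 -
  (2 * (gram_form T Ts 2^-1 h - gram_form T Ts 4^-1 h) + cross h (G' h)).
pose C := 2 * (c * c).
have C0 : 0 <= C by rewrite !mulr_ge0.
pose M := (2 * c) ^+ 2 + 4 * C + 4 * c * C + C ^+ 2.
have M0 : 0 <= M by rewrite !addr_ge0 ?mulr_ge0 ?sqr_ge0.
apply: (quadratic_descent _ _ c_ge0 Ts_bound _ M q quarter_weight M0) => {}h.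
  rewrite /q.
  have step : rnorm (lift h - V h) ^+ 2 <= 4^-1 * rnorm (lift (Ts h)) ^+ 2.
    rewrite lift_rec addrAC subrr add0r rnormZ ger0_norm // exprMn.
    have : rnorm (Q (lift (Ts h))) ^+ 2 <= rnorm (lift (Ts h)) ^+ 2.
      by rewrite ler_sqr ?nnegrE ?rnorm_ge0.
    by lra.
  have cross_rec : cross h (G' h) = cross h h + 4^-1 * cross (Ts h) (G' (Ts h)).
    rewrite [G' h](gram_rec _ _ _ T_adj c_ge0 Ts_bound _ quarter_weight).
    by rewrite -cross_comm /cross linearD linear_realZ !rdotDr !rdotZr; ring.
  move: step; rewrite cross_rec [gram_form _ _ 4^-1 h]g'E.
  rewrite -rdotxx !(rdotBl, rdotBr) !rdotxx isometry_norm [rdot (V h) _]rdotC.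
  have -> : cross h h = 2 * rdot (lift h) (V h) - gram_form T Ts 2^-1 h by [].
  by rewrite [gram_form _ _ 2^-1 h]gE; lra.
rewrite /q /cross /gram_form.
have h0 := rnorm_ge0 h.
have n1 : rnorm (lift h) ^+ 2 <= (2 * c * rnorm h) ^+ 2.
  by rewrite ler_sqr ?nnegrE ?rnorm_ge0 ?mulr_ge0 ?lift_le.
have n2 : rnorm (lift h) * rnorm (G' h) <= (2 * c * rnorm h) * (C * rnorm h).
  by rewrite ler_pM ?rnorm_ge0 ?lift_le ?G'_le.
have n3 : rnorm (G h) * rnorm (G' h) <= (C * rnorm h) * (C * rnorm h).
  by rewrite ler_pM ?rnorm_ge0 ?G_le ?G'_le.
have n4 : rnorm (G h) * rnorm h <= C * rnorm h * rnorm h.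
  by rewrite ler_wpM2r ?G_le.
have n5 : rnorm (G' h) * rnorm h <= C * rnorm h * rnorm h.
  by rewrite ler_wpM2r ?G'_le.
have := ler_norm_rdot (lift h) (V (G' h)); rewrite isometry_norm ler_norml.
have := ler_norm_rdot (G h) (G' h); rewrite ler_norml.
have := ler_norm_rdot (G h) h; have := ler_norm_rdot (G' h) h.
rewrite !ler_norml /M => /andP[? ?] /andP[? ?] /andP[? ?] /andP[? ?].
by lra.
Qed.

Lemma gram_cross_le h :
  rdot (G h) (G' h) - rdot (G' h) (G' h) <=
  2 * (gram_form T Ts 2^-1 h - gram_form T Ts 4^-1 h).
Proof.
have : 0 <= rdot (Vs (lift h) - G' h) (Vs (lift h) - G' h).
  by rewrite rdotxx sqr_ge0.
rewrite !(rdotBl, rdotBr) [rdot (Vs _) (G' h)]rdotC (rdotxx (Vs _)).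
rewrite -V_adj [rdot (V _) _]rdotC.
have : rnorm (Vs (lift h)) ^+ 2 <= rnorm (lift h) ^+ 2.
  by rewrite ler_sqr ?nnegrE ?rnorm_ge0 ?coisometry_le.
by have := lift_sqr_le h; rewrite /cross; lra.
Qed.

Lemma dilation_le2 x : rnorm (T x) <= 2 * rnorm x.
Proof.
apply: (@adjoint_le _ _ _ Ts) => // [u v|h].
  by rewrite rdotC -T_adj rdotC.
exact: (@adjoint_le2 _ _ T Ts c T_adj c_ge0 Ts_bound gram_cross_le).
Qed.

End Dilation.

Theorem lemma1 (R : realType) (H : hilbertType R) (T : boundedOp H H) :
  (exists (K : hilbertType R) (Q : boundedOp K K) (V : boundedOp H K),
    let E := fun (n : nat) (x : H) =>
      2 *: adj V (iter n (adj Q) (V x)) - iter n (adj T) x in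
    [/\ (opnorm Q <= 1)%E,
        adj V \o V =1 id,
        (ereal_sup [set opnorm (E n) | n in [set n | (0 < n)%N]] < +oo)%E
      & forall n, (0 < n)%N -> E n \o T =1 T \o E n]) ->
  (opnorm T <= 2%:E)%E.
Proof.
move=> [K [Q [V [Q1 VV Esup ET]]]].
pose E n x := 2 *: adj V (iter n (adj Q) (V x)) - iter n (adj T) x.
have Q_contr x : rnorm (Q x) <= rnorm x.
  by have := opnorm_le_rnorm Q 1 (linear_realZ Q) Q1 x; rewrite mul1r.
have V_iso x : rnorm (V x) <= rnorm x.
  rewrite -ler_sqr ?nnegrE ?rnorm_ge0 // -!rdotxx adjP.
  by have /= -> := VV x.
have Vs_contr y : rnorm (adj V y) <= rnorm y.
  rewrite -[leRHS]mul1r; apply: (adjoint_le V) => // [u v|u]; first exact: adjP.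
  by rewrite mul1r.
have Qs_contr y : rnorm (adj Q y) <= rnorm y.
  rewrite -[leRHS]mul1r; apply: (adjoint_le Q) => // [u v|u]; first exact: adjP.
  by rewrite mul1r.
have EZ n a x : E n (a%:C%C *: x) = a%:C%C *: E n x.
  have iterZ (L : hilbertType R) (f : boundedOp L L) y :
     iter n (adj f) (a%:C%C *: y) = a%:C%C *: iter n (adj f) y.
    elim: n => //= n ->; apply: (adjoint_realZ f); exact: adjP.
  rewrite /E linear_realZ !iterZ (adjoint_realZ V); last exact: adjP.
  by rewrite scalerBr !scalerA mulrC.
have [B [B0 EB]] : exists B : R, 0 <= B /\
    forall n x, (0 < n)%N -> rnorm (E n x) <= B * rnorm x.
  have E_le n : (0 < n)%N -> (opnorm (E n) <= ereal_sup
      [set opnorm (E n) | n in [set n | (0 < n)%N]])%E.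
    by move=> n0; apply: ereal_sup_ubound; exists n.
  have E0 n : E n 0 = 0 by have := EZ n 0 0; rewrite rmorph0 !scale0r.
  have := le_trans (opnorm_ge0 _ (E0 1%N)) (E_le 1%N isT).
  move: Esup E_le; rewrite -/E; case: ereal_sup => [B| |] // _ E_le B0.
  exists B; split=> // n x n0.
  exact: opnorm_le_rnorm (EZ n) (E_le n n0) x.
have Ts_bound n x : rnorm (iter n (adj T) x) <= (B + 2) * rnorm x.
  have x0 := rnorm_ge0 x.
  case: n => [|n]; first by rewrite /= ler_peMl //; lra.
  have -> : iter n.+1 (adj T) x =
      2 *: adj V (iter n.+1 (adj Q) (V x)) - E n.+1 x.
    by rewrite /E opprB addrC subrK.
  have -> : 2 = (2 : R)%:C%C :> R[i] by rewrite rmorph_nat.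
  rewrite (le_trans (ler_rnormD _ _)) // rnormN rnormZ ger0_norm //.
  have h1 : rnorm (adj V (iter n.+1 (adj Q) (V x))) <= rnorm x.
    by rewrite (le_trans (Vs_contr _)) // (le_trans (iter_le _ _ _ Qs_contr)).
  have := EB n.+1 x isT; lra.
apply: rnorm_le_opnorm => //.
apply: (@dilation_le2 _ _ _ T (adj T) (B + 2) (adjP T) _ Ts_bound
  Q (adj Q) V (adj V) (adjP Q) (adjP V)) => //.
  by rewrite addr_ge0.
case=> [|n] x; last exact: ET.
(* The case [n = 0], where the operator is the identity. *)
rewrite /defect /=; have /= -> := VV (T x); have /= -> := VV x.
by rewrite linearB linearZ.
Qed.
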